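(* For each positive integer $m$ we have $\mathcal{P}_m(\mathbb{C}^2)\ne\mathcal{P}_{m+1}(\mathbb{C}^2)$. Thus $\mathcal{P}_1(\mathbb{C}^2)$ is not stable.
   Context: A function $R(z,\overline w)$ on $\mathbb{C}^2\times\mathbb{C}^2$, holomorphic in $z$ and antiholomorphic in $w$, is Hermitian symmetric if $R(z,\overline w)=\overline{R(w,\overline z)}$ for all $z,w$; $\mathcal{P}_0(\mathbb{C}^2)$ is the set of these. For a positive integer $N$, $\mathcal{P}_N(\mathbb{C}^2)$ is the set of $R\in\mathcal{P}_0(\mathbb{C}^2)$ such that $\sum_{i,j=1}^N R(z_i,\overline{z_j})a_i\overline{a_j}\ge 0$ for all $z_1,\dots,z_N\in\mathbb{C}^2$ and $a\in\mathbb{C}^N$; $\mathcal{P}_\infty(\mathbb{C}^2)=\bigcap_{N\ge1}\mathcal{P}_N(\mathbb{C}^2)$. A subset $S\subset\mathcal{P}_0(\mathbb{C}^2)$ is stable if there is a finite positive integer $k$ with $S\cap\mathcal{P}_k(\mathbb{C}^2)=S\cap\mathcal{P}_\infty(\mathbb{C}^2)$. *)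

(* Defs.v *)
From HB Require Import structures.
From mathcomp Require Import all_boot all_order all_algebra.
From mathcomp Require Import all_classical all_reals all_analysis.
From mathcomp Require Import complex.

Set Implicit Arguments.
Unset Strict Implicit.
Unset Printing Implicit Defensive.

Import Order.TTheory GRing.Theory Num.Theory.
Import numFieldNormedType.Exports.

Local Open Scope classical_set_scope.
Local Open Scope ring_scope.

(* Naming R[i] as a numClosedFieldType lets it inherit the normed module
   structure (over itself) that every numClosedFieldType carries. *)
Definition Cplx (R : realType) : numClosedFieldType := R[i]%C.

Definition C2 (R : realType) : normedModType (Cplx R) := 'rV[Cplx R]_2.

(* Frechet differentiability over the complex scalars at every point. *)
Definition holomorphic (R : realType) (f : C2 R -> Cplx R) : Prop :=
  forall z : C2 R, differentiable f z.

(* A function R(z, conj w) is represented by F : z |-> w |-> R(z, conj w). *)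
Definition herm (R : realType) : set (C2 R -> C2 R -> Cplx R) :=
  [set F | [/\ forall w, holomorphic (fun z => F z w),
               forall z, holomorphic (fun w => (F z w)^*)
             & forall z w, F z w = (F w z)^*]].

(* In Cplx R, 0 <= x means that x is real and nonnegative. *)
Definition Ppos (R : realType) (N : nat) : set (C2 R -> C2 R -> Cplx R) :=
  [set F | herm F /\
    forall (z : 'I_N -> C2 R) (a : 'I_N -> Cplx R),
      0 <= \sum_(i < N) \sum_(j < N) F (z i) (z j) * a i * (a j)^*].

Definition Pinfty (R : realType) : set (C2 R -> C2 R -> Cplx R) :=
  \bigcap_(N in [set N : nat | (0 < N)%N]) @Ppos R N.

(* Meaningful for S `<=` herm R, which holds for S = Ppos R N. *)
Definition stable (R : realType) (S : set (C2 R -> C2 R -> Cplx R)) : Prop :=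
  exists2 k : nat, (0 < k)%N & S `&` @Ppos R k = S `&` @Pinfty R.

Arguments herm R : clear implicits.
Arguments Ppos R N : clear implicits.
Arguments Pinfty R : clear implicits.

(* Main.v *)
Require Import Defs.
From mathcomp Require Import all_boot all_order all_algebra.
From mathcomp Require Import cyclic separable cyclotomic.
From mathcomp Require Import all_classical all_reals all_analysis.
From mathcomp Require Import ring zify.

(** Functions of the first coordinate alone already separate the classes.
    Testing a kernel of the form R(z, conj w) = sum_s c_s (z conj w)^s on
    points t_1, ..., t_N with weights a_1, ..., a_N only sees the moments
    x_s = sum_p a_p t_p^s: the quadratic form equals sum_s c_s |x_s|^2.  If
    c_s counts the pairs (j, k) of integers in [0, m] with j + k = s, this is
    the squared Frobenius norm of the Hankel matrix X = (x_{j+k}), of size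
    n = m + 1.  The number of points bounds the rank of X, and rank is
    what the kernel

      m (sum_{j,k <= m} (z conj w)^(j+k)) - n^2 (z conj w)^m

    detects.  Let J be the matrix with ones on the antidiagonal; then
    tr (X J) = n x_m.

    - With m points, X J has rank at most m, so
      |tr (X J)|^2 <= m ||X||^2, and the form is nonnegative
      (moment_bound, from Hankel_norm_lower_bound).
    - With m + 1 points at the n-th roots of unity, suitable weights make
      all of x_0, ..., x_{2m} vanish except x_m = n.  Then X = n J, and the
      form is m n^3 - n^4 = - n^3 < 0 (profile_roots_lt0).

    So the kernel lies in the m-th class but not in the next one.  As the
    classes decrease (Ppos_anti), an index k witnessing stability of the first
    class would make the k-th class equal to the intersection of all of
    them, and the kernel for m = k rules this out. *)

Set Implicit Arguments.
Unset Strict Implicit.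
Unset Printing Implicit Defensive.
Import Order.TTheory GRing.Theory Num.Theory.
Import numFieldNormedType.Exports.
Local Open Scope classical_set_scope.
Local Open Scope ring_scope.

(** * Hankel matrices of small rank *)

Lemma Cauchy_Schwarz_sum (C : numClosedFieldType) (I : finType) (f g : I -> C) :
  `|\sum_i f i * g i| ^+ 2 <=
    (\sum_i `|f i| ^+ 2) * (\sum_i `|g i| ^+ 2).
Proof.
set T := \sum_i f i * g i; set A := \sum_i `|f i| ^+ 2.
set B := \sum_i `|g i| ^+ 2.
have B_ge0 : 0 <= B by apply: sumr_ge0 => i _; rewrite exprn_ge0.
have conjB : B^* = B by apply/CrealP/ger0_real.
have [B0 | B_neq0] := eqVneq B 0.
  have g0 i : g i = 0.
    have /psumr_eq0P : B = 0 by [].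
    move=> /(_ (fun i _ => exprn_ge0 2 (normr_ge0 (g i)))) /(_ i isT) /eqP.
    by rewrite expf_eq0 normr_eq0 => /andP[_ /eqP].
  rewrite /T big1 ?normr0 ?expr0n ?B0 ?mulr0 // => i _.
  by rewrite g0 mulr0.
have B_gt0 : 0 < B by rewrite lt_def B_neq0.
(* B f - T conj(g) is B times the component of f orthogonal to conj(g). *)
have expand : \sum_i `|B * f i - T * (g i)^*| ^+ 2 = B * (A * B - `|T| ^+ 2).
  transitivity (\sum_i (B ^+ 2 * `|f i| ^+ 2 - B * T^* * (f i * g i)
      - B * T * (f i * g i)^* + `|T| ^+ 2 * `|g i| ^+ 2)).
    apply: eq_bigr => i _.
    by rewrite !normCK rmorphB !rmorphM /= conjCK conjB; ring.
  rewrite big_split !sumrB /= -!mulr_sumr -rmorph_sum /= -/T -/A -/B normCK.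
  by ring.
rewrite -subr_ge0 -(pmulr_rge0 _ B_gt0) -expand.
by apply: sumr_ge0 => i _; rewrite exprn_ge0.
Qed.

(** A left kernel vector xi makes X = (x_{j+k}) singular.  The matrix D below
    is |xi|^2 times the orthogonal projection onto the complement of conj(xi),
    so D X = |xi|^2 X and tr (D X J) = |xi|^2 (m + 1) x_m, while
    ||D||^2 = |xi|^4 m.  Cauchy-Schwarz between D and X J concludes. *)
Lemma Hankel_norm_lower_bound (C : numClosedFieldType) (m : nat)
    (x : nat -> C) (xi : 'I_m.+1 -> C) (i0 : 'I_m.+1) :
  xi i0 != 0 ->
  (forall k : nat, \sum_l xi l * x (l + k)%N = 0) ->
  m.+1%:R ^+ 2 * `|x m| ^+ 2 <=
    m%:R * \sum_(j < m.+1) \sum_(k < m.+1) `|x (j + k)%N| ^+ 2.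
Proof.
move=> xi_neq0 xi_ker; set S := (X in _ <= _ * X).
pose nu : C := \sum_l `|xi l| ^+ 2.
have nu_gt0 : 0 < nu.
  rewrite /nu (bigD1 i0) //= ltr_pwDl ?exprn_gt0 ?normr_gt0 //.
  by apply: sumr_ge0 => i _; rewrite exprn_ge0.
have conj_nu : nu^* = nu by apply/CrealP/gtr0_real.
pose D (j l : 'I_m.+1) : C := nu * (j == l)%:R - (xi j)^* * xi l.
have normD : \sum_(p : 'I_m.+1 * 'I_m.+1) `|D p.1 p.2| ^+ 2 = nu ^+ 2 * m%:R.
  rewrite -(pair_bigA _ (fun j l => `|D j l| ^+ 2)) /=.
  transitivity (\sum_j (nu ^+ 2 - nu * `|xi j| ^+ 2)).
    apply: eq_bigr => j _.
    transitivity (\sum_l ((j == l)%:R * (nu ^+ 2 - nu * `|xi l| ^+ 2 *+ 2)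
                          + `|xi j| ^+ 2 * `|xi l| ^+ 2)).
      apply: eq_bigr => l _; rewrite /D !normCK rmorphB !rmorphM /=.
      rewrite conjCK conj_nu rmorph_nat.
      have [<-|_] := eqVneq j l; rewrite ?mulr1n ?mulr0n.
        by ring.
      by ring.
    rewrite big_split /= -mulr_sumr -/nu (bigD1 j) //= eqxx big1 => [|l].
      by rewrite mulr1n; ring.
    by rewrite eq_sym => /negbTE->; rewrite mul0r.
  rewrite sumrB sumr_const card_ord -mulr_sumr -/nu -(mulr_natr (nu ^+ 2)) mulrS.
  by ring.
have traceD : \sum_(p : 'I_m.+1 * 'I_m.+1) D p.1 p.2 * x (p.2 + rev_ord p.1)%N
    = nu * (m.+1%:R * x m).
  rewrite -(pair_bigA _ (fun j l => D j l * x (l + rev_ord j)%N)) /=.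
  transitivity (\sum_(j < m.+1) nu * x m); last first.
    by rewrite sumr_const card_ord mulr_natl mulrnAr.
  apply: eq_bigr => j _.
  transitivity (\sum_l (nu * (j == l)%:R * x (l + (m - j))%N
                        - (xi j)^* * (xi l * x (l + (m - j))%N))).
    by apply: eq_bigr => l _; rewrite /D subSS; ring.
  rewrite sumrB -mulr_sumr xi_ker mulr0 subr0 (bigD1 j) //= eqxx big1 => [|l].
    by rewrite subnKC ?mulr1 ?addr0 // -ltnS.
  by rewrite eq_sym => /negbTE->; rewrite mulr0 mul0r.
have normX : \sum_(p : 'I_m.+1 * 'I_m.+1) `|x (p.2 + rev_ord p.1)%N| ^+ 2 = S.
  rewrite -(pair_bigA _ (fun j l : 'I_m.+1 => `|x (l + rev_ord j)%N| ^+ 2)) /=.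
  rewrite (reindex_inj rev_ord_inj) /S; apply: eq_bigr => j _ /=.
  by apply: eq_bigr => l _; rewrite subSS subKn ?(addnC l) // -ltnS.
have := Cauchy_Schwarz_sum
  (fun p : 'I_m.+1 * 'I_m.+1 => D p.1 p.2) (fun p => x (p.2 + rev_ord p.1)%N).
rewrite traceD normD normX normrM (gtr0_norm nu_gt0) exprMn -[X in _ <= X]mulrA.
rewrite ler_pM2l ?exprn_gt0 // normrM exprMn normr_nat.
by [].
Qed.

(** * Moments of point evaluations *)

Definition moment (C : numClosedFieldType) (N : nat) (t a : 'I_N -> C)
    (s : nat) : C :=
  \sum_p a p * t p ^+ s.

(** With m points, the coefficients of the monic polynomial q of degree m
    vanishing at all of them give a kernel vector: the pairing of q with the
    k-th row is sum_p a_p t_p^k q(t_p) = 0. *)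
Lemma moment_bound (C : numClosedFieldType) (m : nat) (t a : 'I_m -> C) :
  m.+1%:R ^+ 2 * `|moment t a m| ^+ 2 <=
    m%:R * \sum_(j < m.+1) \sum_(k < m.+1) `|moment t a (j + k)| ^+ 2.
Proof.
pose q := \prod_(p < m) ('X - (t p)%:P).
have size_q : size q = m.+1.
  by rewrite size_prod_XsubC /index_enum -enumT size_enum_ord.
apply: (@Hankel_norm_lower_bound _ _ (moment t a) (fun l : 'I_m.+1 => q`_l) ord_max).
  have /monicP : q \is monic by apply: monic_prod_XsubC.
  by rewrite /lead_coef size_q /= => ->; rewrite oner_neq0.
move=> k; transitivity (\sum_p a p * t p ^+ k * q.[t p]).
  under eq_bigr do rewrite mulr_sumr.
  rewrite exchange_big; apply: eq_bigr => p _ /=.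
  rewrite horner_coef size_q mulr_sumr; apply: eq_bigr => l _.
  by rewrite exprD; ring.
apply: big1 => p _; rewrite horner_prod (bigD1 p) //= hornerXsubC subrr.
by rewrite mul0r mulr0.
Qed.

(** * Roots of unity *)

(** 'X^n - 1 splits and is separable in characteristic 0, so it has n distinct
    roots, and a finite subgroup of a field is cyclic. *)
Lemma prim_root_exists (C : numClosedFieldType) (n : nat) :
  (0 < n)%N -> exists w : C, n.-primitive_root w.
Proof.
move=> n_gt0; have [r Dp] := closed_field_poly_normal ('X^n - 1 : {poly C}).
rewrite (monicP _) ?monicXnsubC // scale1r in Dp.
suff /hasP[w _ prim_w] : has n.-primitive_root r by exists w.
apply: has_prim_root => //.
- by apply/allP=> z; rewrite -root_prod_XsubC -Dp.
- by rewrite -separable_prod_XsubC -Dp separable_Xn_sub_1 // pnatr_eq0 -lt0n.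
- by rewrite -ltnS -(size_prod_XsubC r id) -Dp size_XnsubC.
Qed.

Lemma sum_prim_root_powers (C : numClosedFieldType) (n d : nat) (w : C) :
  n.-primitive_root w ->
  \sum_(i < n) (w ^+ i) ^+ d = if (n %| d)%N then n%:R else 0.
Proof.
move=> prim_w; under eq_bigr do rewrite exprAC.
case: ifPn => [|ndvd_d].
  rewrite (prim_order_dvd prim_w) => /eqP->.
  by under eq_bigr do rewrite expr1n; rewrite sumr_const card_ord.
apply/eqP; rewrite (prim_order_dvd prim_w) -subr_eq0 in ndvd_d.
rewrite -(mulrI_eq0 _ (mulfI ndvd_d)) -subrX1.
by rewrite exprAC (prim_expr_order prim_w) expr1n subrr.
Qed.

(** * The separating kernel *)

(** As a function of u = z conj w. *)
Definition profile (C : numClosedFieldType) (m : nat) (u : C) : C :=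
  m%:R * (\sum_(j < m.+1) \sum_(k < m.+1) u ^+ (j + k))
  - m.+1%:R ^+ 2 * u ^+ m.

Definition pairing (R : realType) (z w : C2 R) : Cplx R :=
  z ord0 ord0 * (w ord0 ord0)^*.

Definition separating (R : realType) (m : nat) (z w : C2 R) : Cplx R :=
  profile m (pairing z w).

Lemma profile_conj (C : numClosedFieldType) (m : nat) (u : C) :
  profile m u^* = (profile m u)^*.
Proof.
rewrite /profile rmorphB rmorphM rmorph_nat rmorph_sum rmorphM !rmorphXn /=.
rewrite rmorph_nat; congr (_ * _ - _).
apply: eq_bigr => j _; rewrite rmorph_sum; apply: eq_bigr => k _ /=.
by rewrite rmorphXn.
Qed.

Lemma separating_sym (R : realType) (m : nat) (z w : C2 R) :
  separating m z w = (separating m w z)^*.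
Proof.
by rewrite /separating -profile_conj /pairing rmorphM /= conjCK mulrC.
Qed.

Lemma separating_holomorphic (R : realType) (m : nat) (w : C2 R) :
  holomorphic (fun z => separating m z w).
Proof.
move=> z; pose u (y : C2 R) : Cplx R := pairing y w.
have du : differentiable u z.
  by apply: differentiableM; [exact: differentiable_coord|
                              exact: differentiable_cst].
have duX s : differentiable (u ^+ s) z.
  by case: s => [|s]; [exact: differentiable_cst | exact: differentiableX].
have -> : (fun z => separating m z w) =
    cst m%:R * (\sum_(j < m.+1) \sum_(k < m.+1) u ^+ (j + k))
    - cst (m.+1%:R ^+ 2) * u ^+ m.
  apply/funext => y; rewrite /separating /profile.
  have uXE s : (u ^+ s) y = u y ^+ s.
    by elim: s => [|s IHs]; rewrite ?expr0 // !exprS -IHs.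
  rewrite -uXE; congr (_ * _ - _); rewrite fct_sumE; apply: eq_bigr => j _.
  by rewrite fct_sumE; apply: eq_bigr => k _; rewrite uXE.
apply: differentiableB.
  apply: differentiableM; first exact: differentiable_cst.
  by apply: differentiable_sum => j; apply: differentiable_sum.
by apply: differentiableM; first exact: differentiable_cst.
Qed.

Lemma separating_herm (R : realType) (m : nat) : herm R (@separating R m).
Proof.
split=> [w|z|z w]; [exact: separating_holomorphic| | exact: separating_sym].
rewrite (_ : (fun w => _) = fun w => separating m w z).
  exact: separating_holomorphic.
by apply/funext => w; rewrite -separating_sym.
Qed.

(** * The quadratic form of the kernel *)

Lemma moment_quadratic (C : numClosedFieldType) (N s : nat) (t a : 'I_N -> C) :
  \sum_(i < N) \sum_(j < N) (t i * (t j)^*) ^+ s * a i * (a j)^* =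
    `|moment t a s| ^+ 2.
Proof.
rewrite normCK /moment rmorph_sum mulr_suml; apply: eq_bigr => i _.
rewrite mulr_sumr; apply: eq_bigr => j _ /=.
by rewrite rmorphM rmorphXn exprMn /=; ring.
Qed.

Lemma profile_quadratic (C : numClosedFieldType) (m N : nat) (t a : 'I_N -> C) :
  \sum_(i < N) \sum_(j < N) profile m (t i * (t j)^*) * a i * (a j)^* =
    m%:R * (\sum_(j < m.+1) \sum_(k < m.+1) `|moment t a (j + k)| ^+ 2)
    - m.+1%:R ^+ 2 * `|moment t a m| ^+ 2.
Proof.
transitivity (\sum_(i < N) \sum_(j < N)
    (m%:R * (\sum_(l < m.+1) \sum_(k < m.+1)
               (t i * (t j)^*) ^+ (l + k) * a i * (a j)^*)
     - m.+1%:R ^+ 2 * ((t i * (t j)^*) ^+ m * a i * (a j)^*))).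
  apply: eq_bigr => i _; apply: eq_bigr => j _.
  rewrite /profile !mulrBl !mulrA -!(mulrA m%:R); congr (m%:R * _ - _).
  rewrite !mulr_suml; apply: eq_bigr => l _.
  by rewrite !mulr_suml.
under eq_bigr do rewrite sumrB -!mulr_sumr.
rewrite sumrB -!mulr_sumr moment_quadratic; congr (_ * _ - _).
under eq_bigr do rewrite exchange_big.
rewrite exchange_big; apply: eq_bigr => l _ /=.
under eq_bigr do rewrite exchange_big.
by rewrite exchange_big; apply: eq_bigr => k _; rewrite -moment_quadratic.
Qed.

Lemma separating_in_Ppos (R : realType) (m : nat) : Ppos R m (@separating R m).
Proof.
split=> [|z a]; first exact: separating_herm.
by rewrite profile_quadratic subr_ge0 moment_bound.
Qed.

(** The target exponent is s = m, and w^(-im) = w^i because w has order m + 1: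
    this is why the weights coincide with the points.  Among the exponents
    s + 1 in [1, 2m + 1], only m + 1 is a multiple of m + 1. *)
Lemma moment_roots (C : numClosedFieldType) (m s : nat) (w : C) :
  m.+1.-primitive_root w -> (s <= m + m)%N ->
  moment (fun i : 'I_m.+1 => w ^+ i) (fun i => w ^+ i) s =
    if s == m then m.+1%:R else 0.
Proof.
move=> prim_w s_le; rewrite /moment.
under eq_bigr do rewrite -exprS.
rewrite (sum_prim_root_powers _ prim_w); congr (if _ then _ else _).
apply/idP/eqP => [/dvdnP[[|[|k]] eq_s] | ->]; last exact: dvdnn.
- by [].
- by move: eq_s; rewrite mul1n => -[].
- by nia.
Qed.

Lemma Hankel_norm_roots (C : numClosedFieldType) (m : nat) (w : C) :
  m.+1.-primitive_root w ->
  let x := moment (fun i : 'I_m.+1 => w ^+ i) (fun i => w ^+ i) in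
  \sum_(j < m.+1) \sum_(k < m.+1) `|x (j + k)%N| ^+ 2 = m.+1%:R ^+ 3.
Proof.
move=> prim_w x.
transitivity (\sum_(j < m.+1) (m.+1%:R ^+ 2 : C)); last first.
  by rewrite sumr_const card_ord -(mulr_natr (_ ^+ 2)) -exprSr.
have le_m (i : 'I_m.+1) : (i <= m)%N by rewrite -ltnS.
apply: eq_bigr => j _; rewrite (bigD1 (rev_ord j)) //= big1 => [|k k_neq].
  by rewrite subSS subnKC // /x moment_roots ?leq_addr // eqxx normr_nat addr0.
rewrite /x moment_roots ?leq_add //.
case: eqP => [jk|_]; last by rewrite normr0 expr0n.
by case/eqP: k_neq; apply/val_inj => /=; rewrite subSS -[X in (X - _)%N]jk addKn.
Qed.

Lemma profile_roots_lt0 (C : numClosedFieldType) (m : nat) (w : C) :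
  m.+1.-primitive_root w ->
  \sum_(i < m.+1) \sum_(j < m.+1)
     profile m (w ^+ i * (w ^+ j)^*) * w ^+ i * (w ^+ j)^* < 0.
Proof.
move=> prim_w; rewrite (profile_quadratic m (fun i : 'I_m.+1 => w ^+ i)).
rewrite Hankel_norm_roots // moment_roots ?leq_addr // eqxx normr_nat.
rewrite (_ : _ - _ = - m.+1%:R ^+ 3); last by rewrite [in LHS]mulrS; ring.
by rewrite oppr_lt0 exprn_gt0 ?ltr0n.
Qed.

Lemma separating_notin_PposS (R : realType) (m : nat) :
  ~ Ppos R m.+1 (@separating R m).
Proof.
have [w prim_w] := prim_root_exists (Cplx R) (ltn0Sn m).
case=> _ /(_ (fun i => const_mx (w ^+ i)) (fun i => w ^+ i)).
under eq_bigr => i _ do under eq_bigr => j _ do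
  rewrite /separating /pairing !mxE.
by rewrite (lt_geF (profile_roots_lt0 prim_w)).
Qed.

(** * Monotonicity and conclusion *)

(** A family of N points is padded by an extra point of weight 0. *)
Lemma PposS (R : realType) (N : nat) : Ppos R N.+1 `<=` Ppos R N.
Proof.
move=> F [hF F_ge0]; split=> // z a.
pose z' i := if unlift ord0 i is Some j then z j else 0.
pose a' i := if unlift ord0 i is Some j then a j else 0.
have := F_ge0 z' a'; rewrite big_ord_recl big1 => [|j _]; last first.
  by rewrite /a' unlift_none mulr0 mul0r.
rewrite add0r; congr (0 <= _); apply: eq_bigr => i _.
rewrite big_ord_recl {2}/a' unlift_none conjC0 mulr0 add0r.
by apply: eq_bigr => j _; rewrite /z' /a' !liftK.
Qed.

Lemma Ppos_anti (R : realType) (M N : nat) :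
  (M <= N)%N -> Ppos R N `<=` Ppos R M.
Proof.
move=> /subnK <-; elim: (N - M)%N => // d IHd F /PposS; exact: IHd.
Qed.

Theorem mainTheorem4 (R : realType) :
  (forall m : nat, (0 < m)%N -> Ppos R m <> Ppos R m.+1) /\
  ~ stable (Ppos R 1).
Proof.
split=> [m _ eqP|[k k_gt0 eqP]].
  by apply: (@separating_notin_PposS R m); rewrite -eqP; exact: separating_in_Ppos.
apply: (@separating_notin_PposS R k); have Fk := @separating_in_Ppos R k.
suff [_ /(_ k.+1 isT)] : (Ppos R 1 `&` Pinfty R) (@separating R k) by [].
by rewrite -eqP; split=> //; exact: Ppos_anti Fk.
Qed.
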